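(* Let $n, m \ge 1$ be integers. The domination polynomial $D_{R_{n,m}}(x)$ of the $n\times m$ rook graph $R_{n,m}$ can be written as $$D_{R_{n,m}}(x) = \big((1+x)^n-1\big)^m - (-1)^m \sum_{k=0}^{m-1} (-1)^{k}\binom{m}{k}\big((1+x)^k-1\big)^{n}.$$
   Context: The rook graph $R_{n,m}$ has as vertices the $nm$ squares of an $n\times m$ chessboard ($n$ rows, $m$ columns); two distinct squares are adjacent if and only if they lie in the same row or in the same column. (Equivalently, $R_{n,m}$ is the Cartesian product of the complete graphs $K_n$ and $K_m$.) A subset $S\subseteq V$ of the vertices of a graph $G=(V,E)$ is a dominating set if every vertex $v\in V$ is an element of $S$ or is adjacent to an element of $S$. Let $d_G(k)$ denote the number of dominating sets of $G$ of cardinality $k$, and let $\gamma_G$ be the minimum cardinality of a dominating set of $G$. The domination polynomial of $G$ is $D_G(x)=\sum_{k=\gamma_G}^{|V|} d_G(k)\,x^k$. *)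

(* Defs.v *)
From HB Require Import structures.
From mathcomp Require Import all_boot all_order all_algebra.

Set Implicit Arguments.
Unset Strict Implicit.
Unset Printing Implicit Defensive.

Import GRing.Theory.
Local Open Scope ring_scope.

(* A finite simple graph is given by a symmetric irreflexive adjacency relation
   on a finType; the definitions below apply to any such relation. *)
Section Domination.

Variables (T : finType) (adj : rel T).

Definition dominating (S : {set T}) : bool :=
  [forall v, (v \in S) || [exists u in S, adj v u]].

Definition dom_count (k : nat) : nat :=
  #|[set S : {set T} | dominating S & #|S| == k]|.

Lemma dominatingT : dominating [set: T].
Proof. by apply/forallP => v; rewrite inE. Qed.

(* The default set [set: T] always dominates (dominatingT), so the arg min is a
   dominating set of least cardinality. *)
Definition dom_number : nat :=
  #|[arg min_(S < [set: T] | dominating S) #|S|]|.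

Definition dom_poly : {poly int} :=
  \sum_(dom_number <= k < #|T|.+1) (dom_count k)%:R *: 'X^k.

End Domination.

Definition rook (n m : nat) : rel ('I_n * 'I_m) :=
  fun u v => (u != v) && ((u.1 == v.1) || (u.2 == v.2)).

Lemma rook_sym (n m : nat) : symmetric (@rook n m).
Proof.
by move=> u v; rewrite /rook eq_sym (eq_sym u.1) (eq_sym u.2).
Qed.

Lemma rook_irr (n m : nat) : irreflexive (@rook n m).
Proof. by move=> u; rewrite /rook eqxx. Qed.

(* Main.v *)
Require Import Defs.
From HB Require Import structures.
From mathcomp Require Import all_boot all_order all_algebra.

Set Implicit Arguments.
Unset Strict Implicit.
Unset Printing Implicit Defensive.

Import GRing.Theory.
Local Open Scope ring_scope.

(** A set of squares dominates the rook graph exactly when it meets every row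
or meets every column: an empty row and an empty column cross in a square that
is not dominated, and a full set of rows (or of columns) plainly dominates.
Write the domination polynomial as the sum of [x ^+ #|S|] over dominating [S]
([dom_poly_sum]).  It splits into two parts.

- The sets meeting all columns.  Such a set is an independent choice of a
  nonempty subset of each column, whence [((1 + x)^n - 1)^m].
- The sets meeting all rows but missing some column.  The sets that meet all
  rows and lie in a prescribed set [A] of columns have generating function
  [((1 + x)^#|A| - 1)^n] ([sum_rows_full]).  Inclusion-exclusion over the proper
  subsets [A] of the columns that contain all occupied columns
  ([signed_supersets]) isolates those that miss a column, and collecting the
  [A] by cardinality produces the binomial sum. *)

Lemma sum_by_card (T : finType) (V : zmodType) (P : pred {set T})
    (F : nat -> V) :
  \sum_(S : {set T} | P S) F #|S| =
  \sum_(0 <= k < #|T|.+1) F k *+ #|[set S : {set T} | P S & #|S| == k]|.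
Proof.
pose ord_card S : 'I_#|T|.+1 := inord #|(S : {set T})|.
rewrite big_mkord (partition_big ord_card xpredT) //=.
apply: eq_bigr => k _; rewrite -sumr_const.
apply: eq_big => [S|S /andP[_ /eqP <-]].
  by rewrite inE -val_eqE /= inordK // ltnS max_card.
by rewrite inordK // ltnS max_card.
Qed.

Lemma sum_sets_card (T : finType) (V : zmodType) (F : nat -> V) :
  \sum_(S : {set T}) F #|S| = \sum_(0 <= k < #|T|.+1) F k *+ 'C(#|T|, k).
Proof.
rewrite sum_by_card; apply: eq_bigr => k _.
by rewrite -card_draws.
Qed.

(** Below [dom_number] no dominating set exists, so the truncation of the range
of exponents in [dom_poly] loses no term. *)
Lemma dom_poly_sum (T : finType) (adj : rel T) :
  dom_poly adj = \sum_(S : {set T} | dominating adj S) 'X^#|S|.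
Proof.
rewrite sum_by_card /dom_poly.
have min_dom S : dominating adj S -> (dom_number adj <= #|S|)%N.
  rewrite /dom_number; case: arg_minnP => [|S0 _ minS0]; first exact: dominatingT.
  exact: minS0.
rewrite [RHS](@big_cat_nat _ _ _ (dom_number adj)) //=; last first.
  by rewrite ltnW // ltnS max_card.
rewrite [X in _ = X + _]big_nat [X in _ = X + _]big1 ?add0r => [|k /andP[_ ltk]].
  by apply: eq_bigr => k _; rewrite scaler_nat.
rewrite (_ : [set S | _ & _] = set0) ?cards0 //.
apply/setP => S; rewrite !inE; apply/negP => /andP[/min_dom le_dS Sk].
by rewrite leqNgt (eqP Sk) ltk in le_dS.
Qed.

(** Expand the product over all points of [1 + x] (inside [A]) or [1 + 0]
(outside [A]): the zero kills the sets that leave [A]. *)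
Lemma sum_subsets (T : finType) (R : comNzRingType) (x : R) (A : {set T}) :
  \sum_(B : {set T} | B \subset A) x ^+ #|B| = (1 + x) ^+ #|A|.
Proof.
transitivity (\prod_i ((if i \in A then x else 0) + 1)); last first.
  rewrite -prodr_const [RHS]big_mkcond /=.
  by apply: eq_bigr => i _; case: ifP => _; rewrite ?add0r // addrC.
rewrite bigA_distr big_mkcond /=; apply: eq_bigr => B _.
rewrite -big_mkcond /=.
case: ifPn => [/subsetP sBA|/subsetPn[i iB /negPf iA]].
  by rewrite -prodr_const; apply: eq_bigr => i /sBA ->.
by rewrite (bigD1 i) //= iA mul0r.
Qed.

(** Complements of the supersets of [C] are the subsets of the complement of
[C], whose signed count is a power of [1 - 1]. *)
Lemma signed_supersets (T : finType) (R : comNzRingType) (C : {set T}) :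
  \sum_(A : {set T} | C \subset A) (-1) ^+ #|~: A| = (C == setT)%:R :> R.
Proof.
rewrite (reindex_inj (@setC_inj T)) /=.
under eq_bigl => A do rewrite -setCS setCK.
under eq_bigr => A _ do rewrite setCK.
by rewrite sum_subsets subrr expr0n cards_eq0 -(inj_eq (@setC_inj T)) setCK setC0.
Qed.

Section Boards.

Variables (I J : finType).
Implicit Type S : {set I * J}.

Definition row_of S (i : I) : {set J} := [set j | (i, j) \in S].
Definition rows_full S := [forall i, row_of S i != set0].
Definition used_cols S : {set J} := \bigcup_i row_of S i.

Definition set_of_rows (f : {ffun I -> {set J}}) : {set I * J} :=
  [set p | p.2 \in f p.1].

Lemma row_set_of_rows f i : row_of (set_of_rows f) i = f i.
Proof. by apply/setP => j; rewrite !inE. Qed.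

Lemma set_of_rows_bij : bijective set_of_rows.
Proof.
exists (fun S => [ffun i => row_of S i]) => [f|S].
  by apply/ffunP => i; rewrite ffunE row_set_of_rows.
by apply/setP => -[i j]; rewrite inE ffunE inE.
Qed.

Lemma card_rows S : #|S| = (\sum_i #|row_of S i|)%N.
Proof.
under eq_bigr => i _ do rewrite -sum1_card.
rewrite pair_big_dep -sum1_card /=.
by apply: eq_bigl => -[i j]; rewrite inE.
Qed.

(** A set that meets every row and stays in the columns [A] is an independent
choice, for each row, of a nonempty subset of [A]. *)
Lemma sum_rows_full (R : comNzRingType) (x : R) (A : {set J}) :
  \sum_(S : {set I * J} | rows_full S && (used_cols S \subset A)) x ^+ #|S| =
  ((1 + x) ^+ #|A| - 1) ^+ #|I|.
Proof.
have nonempty : (1 + x) ^+ #|A| - 1 =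
    \sum_(B : {set J} | (B != set0) && (B \subset A)) x ^+ #|B|.
  rewrite -sum_subsets (bigD1 set0) ?sub0set //= cards0 expr0 [LHS]addrC addKr.
  by apply: eq_bigl => B; rewrite andbC.
rewrite nonempty -prodr_const.
rewrite (eq_bigl xpredT) // bigA_distr_big /=.
rewrite (reindex _ (onW_bij _ set_of_rows_bij)) /=.
apply: eq_big => [f|f _].
  apply/andP/ffun_onP => [[/forallP ne /bigcupsP sub] i|fP].
    by rewrite unfold_in -(row_set_of_rows f i) ne sub.
  split; first by apply/forallP => i; rewrite row_set_of_rows; case/andP: (fP i).
  by apply/bigcupsP => i _; rewrite row_set_of_rows; case/andP: (fP i).
rewrite card_rows prodrXr.
by under eq_bigr => i _ do rewrite row_set_of_rows.
Qed.

(** For a set [S] with support [C] in the columns, the signed count of the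
proper supersets of [C] is [0 - 1] if [C] is proper and [1 - 1] otherwise. *)
Lemma sum_rows_full_miss_col (R : comNzRingType) (x : R) :
  \sum_(S : {set I * J} | rows_full S && (used_cols S != setT)) x ^+ #|S| =
  - \sum_(A : {set J} | A != setT)
      (-1) ^+ #|~: A| * ((1 + x) ^+ #|A| - 1) ^+ #|I|.
Proof.
under [in RHS]eq_bigr => A _ do rewrite -sum_rows_full big_distrr /=.
rewrite (exchange_big_dep rows_full) /=; last by move=> A S _ /andP[].
rewrite big_mkcondr /= -sumrN; apply: eq_bigr => S rS.
rewrite rS -mulr_suml -mulNr.
have := signed_supersets R (used_cols S).
rewrite (bigD1 setT) ?subsetT //= setCT cards0 expr0.
under eq_bigl => A do rewrite andbC.
move/(canRL (addKr _)) ->; rewrite opprD opprK.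
by case: eqP => _; rewrite ?subrr ?mul0r // subr0 mul1r.
Qed.

End Boards.

Definition transpose (I J : finType) (S : {set I * J}) : {set J * I} :=
  [set p | (p.2, p.1) \in S].

Lemma transposeK (I J : finType) : cancel (@transpose I J) (@transpose J I).
Proof. by move=> S; apply/setP => -[i j]; rewrite !inE. Qed.

Lemma card_transpose (I J : finType) (S : {set I * J}) :
  #|transpose S| = #|S|.
Proof.
rewrite -!sum1_card [RHS](reindex (fun p : J * I => (p.2, p.1))) /=.
  by apply: eq_bigl => p; rewrite inE.
by exists (fun p => (p.2, p.1)) => -[].
Qed.

Lemma rows_full_transpose (I J : finType) (S : {set I * J}) :
  rows_full (transpose S) = (used_cols S == setT).
Proof.
rewrite -subTset; apply/forallP/subsetP => [full j _|full j].
  case/set0Pn: (full j) => i; rewrite !inE => ijS.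
  by apply/bigcupP; exists i; rewrite ?inE.
have /bigcupP[i _] := full j (in_setT j); rewrite inE => ijS.
by apply/set0Pn; exists i; rewrite !inE.
Qed.

Lemma sum_cols_full (I J : finType) (R : comNzRingType) (x : R) :
  \sum_(S : {set I * J} | used_cols S == setT) x ^+ #|S| =
  ((1 + x) ^+ #|I| - 1) ^+ #|J|.
Proof.
rewrite -[in RHS](cardsT I) -sum_rows_full.
rewrite [RHS](reindex (@transpose I J)) /=; last first.
  by exists (@transpose J I) => S _; apply: transposeK.
apply: eq_big => [S|S _]; last by rewrite card_transpose.
by rewrite rows_full_transpose subsetT andbT.
Qed.

(** If row [i] is empty then, for any column [j], the square dominating [(i, j)]
lies in column [j]; hence every column is used. *)
Lemma rook_dominating (n m : nat) (S : {set 'I_n * 'I_m}) :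
  dominating (@rook n m) S = (used_cols S == setT) || rows_full S.
Proof.
apply/forallP/orP => [dom|full [i j]].
  have [|/forallPn[i]] := boolP (rows_full S); [by right|rewrite negbK => /eqP Si0].
  left; rewrite -subTset; apply/subsetP => j _.
  have ij'S j' : (i, j') \in S = false.
    by have := in_set0 j'; rewrite -Si0 inE.
  have:= dom (i, j); rewrite ij'S /= => /existsP[[i' j'] /and3P[uS _ /= /orP[]]].
    by move/eqP=> ii'; rewrite -ii' ij'S in uS.
  by move/eqP=> ->; apply/bigcupP; exists i'; rewrite ?inE.
case: (boolP ((i, j) \in S)) => //= ijS; apply/existsP.
case: full => [/eqP colS|/forallP/(_ i)/set0Pn[j']].
  have := in_setT j; rewrite -colS => /bigcupP[i' _]; rewrite inE => uS.
  exists (i', j); rewrite uS /rook /= eqxx orbT andbT.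
  by apply: contraNneq ijS => ->.
rewrite inE => uS; exists (i, j'); rewrite uS /rook /= eqxx andbT.
by apply: contraNneq ijS => ->.
Qed.

Theorem theorem4 (n m : nat) (hn : (1 <= n)%N) (hm : (1 <= m)%N) :
  dom_poly (@rook n m) =
    ((1 + 'X) ^+ n - 1) ^+ m
    - (-1) ^+ m * \sum_(0 <= k < m)
        (-1) ^+ k * ('C(m, k))%:R * ((1 + 'X) ^+ k - 1) ^+ n.
Proof.
rewrite dom_poly_sum (bigID (fun S => used_cols S == setT)) /=.
under eq_bigl => S do rewrite rook_dominating andb_idl => [|->] //.
rewrite sum_cols_full !card_ord; congr (_ + _).
under eq_bigl => S do rewrite rook_dominating andb_orl andbN orFb.
rewrite sum_rows_full_miss_col card_ord; congr (- _).
pose F k : {poly int} := (-1) ^+ (m - k) * ((1 + 'X) ^+ k - 1) ^+ n.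
transitivity (\sum_(A : {set 'I_m} | A != setT) F #|A|).
  by apply: eq_bigr => A _; rewrite (cardsCs (~: A)) setCK card_ord.
(* Cancelling the term of the full set of columns against the term [k = m]
   leaves the proper subsets against the range [k < m]. *)
have := sum_sets_card 'I_m F.
rewrite (bigD1 setT) //= cardsT card_ord big_nat_recr //= binn mulr1n addrC.
move/addIr ->; rewrite big_distrr /= !big_nat; apply: eq_bigr => k /andP[_ ltkm].
rewrite /F -[LHS]mulr_natr -signr_odd oddB ?(ltnW ltkm) // signr_addb !signr_odd.
by rewrite -!mulrA [in RHS](mulrC _%:R).
Qed.
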